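(* Let $A \in \mathbb{R}^{n\times m}$ and let $S \geq 1$ be an integer such that the restricted isometry constants of $A$ satisfy $\delta_{3S} + 3\,\delta_{4S} < 2$. Let $\epsilon \ge 0$. Then for any signal $x_0 \in \mathbb{R}^m$ supported on a set $T_0 \subset \{1,\ldots,m\}$ with $|T_0| \leq S$, and any perturbation $e \in \mathbb{R}^n$ with $\|e\|_{\ell_2} \leq \epsilon$, setting $y = A x_0 + e$, any solution $x^\sharp$ to the convex program $$(P_2)\qquad \min_{x\in\mathbb{R}^m}\ \|x\|_{\ell_1} \quad\text{subject to}\quad \|Ax-y\|_{\ell_2} \leq \epsilon$$ obeys $$\|x^\sharp - x_0\|_{\ell_2} \leq C_S\cdot \epsilon,$$ where the constant $C_S$ may only depend on $\delta_{4S}$. For reasonable values of $\delta_{4S}$ this constant is well behaved; e.g. one has $C_S \approx 8.82$ for $\delta_{4S} = 1/5$ and $C_S \approx 10.47$ for $\delta_{4S} = 1/4$.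
   Context: For $T\subset\{1,\ldots,m\}$, $A_T$ denotes the $n\times |T|$ submatrix obtained by extracting the columns of $A$ corresponding to the indices in $T$. For a positive integer $k$, the $k$-restricted isometry constant $\delta_k$ of $A$ is the smallest quantity such that $$(1-\delta_k)\,\|c\|_{\ell_2}^2 \leq \|A_T c\|_{\ell_2}^2 \leq (1+\delta_k)\,\|c\|_{\ell_2}^2$$ for all subsets $T\subset\{1,\ldots,m\}$ with $|T|\leq k$ and all real coefficient sequences $c = (c_j)_{j\in T}$. A vector $x_0$ is supported on $T_0$ if $x_0(t) = 0$ for all $t\notin T_0$. Here $\|\cdot\|_{\ell_1}$ and $\|\cdot\|_{\ell_2}$ are the usual $\ell_1$ and Euclidean norms. That $C_S$ may only depend on $\delta_{4S}$ means that it is determined by the value of $\delta_{4S}$ and does not otherwise depend on $A$, $n$, $m$, $x_0$, $e$ or $\epsilon$. *)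

(* Defs.v *)
From HB Require Import structures.
From mathcomp Require Import all_boot all_order all_algebra.
From mathcomp Require Import boolp classical_sets reals.
From mathcomp Require Import lra.

Set Implicit Arguments.
Unset Strict Implicit.
Unset Printing Implicit Defensive.

Import Order.TTheory GRing.Theory Num.Theory.

Local Open Scope classical_set_scope.
Local Open Scope ring_scope.

(* The norm that MathComp-Analysis puts on matrices is the max-norm, hence the
   two explicit norms below. *)
Definition l1norm (R : realType) (m : nat) (x : 'cV[R]_m) : R :=
  \sum_(i < m) `|x i 0|.

Definition l2norm (R : realType) (m : nat) (x : 'cV[R]_m) : R :=
  Num.sqrt (\sum_(i < m) x i 0 ^+ 2).

(* [enum_val] lists T increasingly; a coefficient sequence (c_j)_{j in T} is
   correspondingly a column vector of length #|T|. *)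
Definition submatrix (R : realType) (n m : nat) (A : 'M[R]_(n, m))
    (T : {set 'I_m}) : 'M[R]_(n, #|T|) :=
  colsub (fun j : 'I_#|T| => enum_val j) A.

Definition rip_bound (R : realType) (n m : nat) (A : 'M[R]_(n, m)) (k : nat)
    (d : R) : Prop :=
  forall (T : {set 'I_m}) (c : 'cV[R]_#|T|), (#|T| <= k)%N ->
    (1 - d) * l2norm c ^+ 2 <= l2norm (submatrix A T *m c) ^+ 2 /\
    l2norm (submatrix A T *m c) ^+ 2 <= (1 + d) * l2norm c ^+ 2.

(* The infimum is a minimum when 0 < k and 0 < m, see [ric_rip_bound] and
   [ric_le].  If m = 0 every real d satisfies [rip_bound] and, by the
   convention on [inf], the value is 0. *)
Definition ric (R : realType) (n m : nat) (A : 'M[R]_(n, m)) (k : nat) : R :=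
  inf [set d | rip_bound A k d].

Definition supported_on (R : realType) (m : nat) (x : 'cV[R]_m)
    (T : {set 'I_m}) : Prop :=
  forall t : 'I_m, t \notin T -> x t 0 = 0.

Definition feasible (R : realType) (n m : nat) (A : 'M[R]_(n, m))
    (y : 'cV[R]_n) (eps : R) (x : 'cV[R]_m) : Prop :=
  l2norm (A *m x - y) <= eps.

Definition is_solution (R : realType) (n m : nat) (A : 'M[R]_(n, m))
    (y : 'cV[R]_n) (eps : R) (x : 'cV[R]_m) : Prop :=
  feasible A y eps x /\
  forall z : 'cV[R]_m, feasible A y eps z -> l1norm x <= l1norm z.

Lemma sqr_l2norm (R : realType) (m : nat) (x : 'cV[R]_m) :
  l2norm x ^+ 2 = \sum_(i < m) x i 0 ^+ 2.
Proof. by rewrite sqr_sqrtr // sumr_ge0 // => i _; rewrite sqr_ge0. Qed.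

Lemma l2norm_mulmx_le (R : realType) (n p : nat) (B : 'M[R]_(n, p)) :
  exists2 K : R, 0 <= K &
    forall c : 'cV[R]_p, l2norm (B *m c) ^+ 2 <= K * l2norm c ^+ 2.
Proof.
exists (\sum_i (\sum_j `|B i j|) ^+ 2) => [|c].
  by rewrite sumr_ge0 // => i _; rewrite sqr_ge0.
rewrite sqr_l2norm mulr_suml; apply: ler_sum => i _.
have c0 : 0 <= l2norm c by rewrite sqrtr_ge0.
rewrite -exprMn -[leLHS]real_normK ?num_real //.
rewrite lerXn2r ?nnegrE ?mulr_ge0 ?sumr_ge0 //.
rewrite mxE (le_trans (ler_norm_sum _ _ _)) // mulr_suml.
apply: ler_sum => j _; rewrite normrM ler_wpM2l //.
rewrite -sqrtr_sqr /l2norm ler_wsqrtr // (bigD1 j) //= lerDl sumr_ge0 // => l _.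
by rewrite sqr_ge0.
Qed.

Lemma rip_bound_nonempty (R : realType) (n m : nat) (A : 'M[R]_(n, m))
    (k : nat) : [set d | rip_bound A k d] !=set0.
Proof.
have /choice[K KP] : forall T : {set 'I_m}, exists K : R, 0 <= K /\
    forall c : 'cV[R]_#|T|,
      l2norm (submatrix A T *m c) ^+ 2 <= K * l2norm c ^+ 2.
  by move=> T; have [K K0 KP] := l2norm_mulmx_le (submatrix A T); exists K.
have K0 T : 0 <= K T by have [] := KP T.
exists (1 + \sum_T K T) => T c _ /=.
have KT : K T <= \sum_U K U by rewrite (bigD1 T) //= lerDl sumr_ge0.
have := (KP T).2 c; have := K0 T.
have := sqr_ge0 (l2norm c); have := sqr_ge0 (l2norm (submatrix A T *m c)).
by split; nra.
Qed.

Lemma rip_bound_ge0 (R : realType) (n m : nat) (A : 'M[R]_(n, m)) (k : nat)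
    (d : R) : (0 < k)%N -> (0 < m)%N -> rip_bound A k d -> 0 <= d.
Proof.
move=> k0; case: m A => // m A _ /(_ [set ord0]%SET (const_mx 1)).
move=> H.
have [|lo hi] := H; first by rewrite cards1.
have s : l2norm (const_mx 1 : 'cV[R]_#|[set (ord0 : 'I_m.+1)]%SET|) ^+ 2 = 1.
  rewrite sqr_l2norm (eq_bigr (fun=> 1)); last by move=> i _; rewrite mxE expr1n.
  by rewrite sumr_const card_ord cards1.
by have := le_trans lo hi; rewrite s; lra.
Qed.

Lemma ric_le (R : realType) (n m : nat) (A : 'M[R]_(n, m)) (k : nat) (d : R) :
  (0 < k)%N -> (0 < m)%N -> rip_bound A k d -> ric A k <= d.
Proof.
move=> k0 m0 dP; apply: ge_inf => //.
by exists 0 => x; exact: rip_bound_ge0.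
Qed.

Lemma ric_rip_bound (R : realType) (n m : nat) (A : 'M[R]_(n, m)) (k : nat) :
  (0 < k)%N -> (0 < m)%N -> rip_bound A k (ric A k).
Proof.
move=> k0 m0 T c Tk.
have hinf : has_inf [set d | rip_bound A k d].
  split; first exact: rip_bound_nonempty.
  by exists 0 => x; exact: rip_bound_ge0.
have [c0|c0] := eqVneq (l2norm c ^+ 2) 0.
  have [d dP] := rip_bound_nonempty A k.
  by have := dP T c Tk; rewrite c0 !mulr0.
have {}c0 : 0 < l2norm c ^+ 2 by rewrite lt_def c0 sqr_ge0.
split; apply/ler_addgt0Pr => e e0.
- have [d dP dlt] := inf_adherent (divr_gt0 e0 c0) hinf.
  have [lo _] := dP T c Tk; rewrite -/(ric A k) in dlt.
  have : d * l2norm c ^+ 2 <= ric A k * l2norm c ^+ 2 + e.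
    by rewrite -[X in _ + X](divfK (lt0r_neq0 c0)) -mulrDl ler_pM2r // ltW.
  by move: lo; lra.
- have [d dP dlt] := inf_adherent (divr_gt0 e0 c0) hinf.
  have [_ hi] := dP T c Tk; rewrite -/(ric A k) in dlt.
  have : d * l2norm c ^+ 2 <= ric A k * l2norm c ^+ 2 + e.
    by rewrite -[X in _ + X](divfK (lt0r_neq0 c0)) -mulrDl ler_pM2r // ltW.
  by move: hi; lra.
Qed.

(* Main.v *)
(* Put h = xs - x0.  Minimality of xs gives |h_{T0^c}|_1 <= |h_{T0}|_1, and
   |A h|_2 <= 2 eps.  Let b = |h_{T0}|_1 / (2 S) and let P consist of T0 and the
   indices where |h| > b, at most 2 S of them outside T0.  With p = h_P, the
   form v |-> <A p, A v> on the remaining entries of h is dominated by its value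
   at a vector u with entries 0, b or -b such that P and the support of u have
   together at most 3 S elements; hence, writing d = delta_3S,
     - <A p, A h_{P^c}> <= <A p, A u> <= d |p| |u| <= d |p|^2 / sqrt 2,
   so that (1 - d - d / sqrt 2) |p| <= 2 eps sqrt (1 + d), while
   |h|^2 <= 3/2 |p|^2.  The hypothesis forces d <= 1/2, and the left factor is
   then bounded away from 0. *)
Require Import Defs.
From mathcomp Require Import all_boot all_order all_algebra.
From mathcomp Require Import reals.
From mathcomp Require Import ring lra.
Import Order.TTheory GRing.Theory Num.Theory.
Local Open Scope ring_scope.

Set Implicit Arguments.
Unset Strict Implicit.
Unset Printing Implicit Defensive.

(** * Euclidean inner product and norm *)

Lemma l2norm_ge0 (R : realType) (n : nat) (u : 'cV[R]_n) : 0 <= l2norm u.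
Proof. exact: sqrtr_ge0. Qed.

Definition dot (R : realType) (n : nat) (u v : 'cV[R]_n) : R :=
  \sum_(i < n) u i 0 * v i 0.

Lemma dotC (R : realType) (n : nat) (u v : 'cV[R]_n) : dot u v = dot v u.
Proof. by apply: eq_bigr => i _; rewrite mulrC. Qed.

Lemma dotDr (R : realType) (n : nat) (u v w : 'cV[R]_n) :
  dot u (v + w) = dot u v + dot u w.
Proof. by rewrite -big_split; apply: eq_bigr => i _; rewrite mxE mulrDr. Qed.

Lemma dotZr (R : realType) (n : nat) (u v : 'cV[R]_n) (t : R) :
  dot u (t *: v) = t * dot u v.
Proof. by rewrite mulr_sumr; apply: eq_bigr => i _; rewrite mxE mulrCA. Qed.

Lemma dot_sumr (R : realType) (n : nat) (I : finType) (P : pred I)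
    (u : 'cV[R]_n) (F : I -> 'cV[R]_n) :
  dot u (\sum_(i | P i) F i) = \sum_(i | P i) dot u (F i).
Proof.
rewrite exchange_big; apply: eq_bigr => i _.
by rewrite summxE mulr_sumr.
Qed.

Lemma dotvv (R : realType) (n : nat) (u : 'cV[R]_n) : dot u u = l2norm u ^+ 2.
Proof. by rewrite sqr_l2norm; apply: eq_bigr => i _; rewrite expr2. Qed.

Lemma sqr_l2normDZ (R : realType) (n : nat) (u v : 'cV[R]_n) (t : R) :
  l2norm (u + t *: v) ^+ 2 =
  l2norm u ^+ 2 + 2 * t * dot u v + t ^+ 2 * l2norm v ^+ 2.
Proof.
rewrite -!dotvv dotDr dotZr ![dot (u + _) _]dotC !dotDr !dotZr (dotC v u).
by ring.
Qed.

Lemma l2norm_eq0 (R : realType) (n : nat) (u : 'cV[R]_n) :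
  l2norm u = 0 -> u = 0.
Proof.
move=> u0; have /eqP : l2norm u ^+ 2 = 0 by rewrite u0 expr0n.
rewrite sqr_l2norm psumr_eq0 => [/allP H|i _]; last exact: sqr_ge0.
apply/matrixP => i j; rewrite ord1 mxE.
by have := H i (mem_index_enum i); rewrite /= sqrf_eq0 => /eqP.
Qed.

Lemma dot0r (R : realType) (n : nat) (u : 'cV[R]_n) : dot u 0 = 0.
Proof. by rewrite /dot big1 // => i _; rewrite mxE mulr0. Qed.

Lemma l2norm0 (R : realType) (n : nat) : l2norm (0 : 'cV[R]_n) = 0.
Proof. by apply/eqP; rewrite -sqrf_eq0 -dotvv dot0r. Qed.

(* The quadratic bound is optimal at t = |u| / |v|, where its right-hand side
   becomes 2 c |u|^2. *)
Lemma le_mul_l2norm (R : realType) (n : nat) (u v : 'cV[R]_n) (c a : R) :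
  u != 0 -> v != 0 ->
  (forall t, 2 * t * a <= c * (l2norm u ^+ 2 + t ^+ 2 * l2norm v ^+ 2)) ->
  a <= c * (l2norm u * l2norm v).
Proof.
move=> un vn /(_ (l2norm u / l2norm v)).
have u0 : 0 < l2norm u.
  by rewrite lt_def l2norm_ge0 andbT; apply: contra_neq un; exact: l2norm_eq0.
have v0 : 0 < l2norm v.
  by rewrite lt_def l2norm_ge0 andbT; apply: contra_neq vn; exact: l2norm_eq0.
have v_neq0 := lt0r_neq0 v0.
rewrite expr_div_n divfK ?sqrf_eq0 // -subr_ge0.
have -> : c * (l2norm u ^+ 2 + l2norm u ^+ 2) -
    2 * (l2norm u / l2norm v) * a =
    2 * (l2norm u / l2norm v) * (c * (l2norm u * l2norm v) - a) by field.
by rewrite pmulr_rge0 ?subr_ge0 // mulr_gt0 // divr_gt0.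
Qed.

Lemma dot_le (R : realType) (n : nat) (u v : 'cV[R]_n) :
  dot u v <= l2norm u * l2norm v.
Proof.
have [->|un] := eqVneq u 0; first by rewrite dotC dot0r mulr_ge0 ?l2norm_ge0.
have [->|vn] := eqVneq v 0; first by rewrite dot0r mulr_ge0 ?l2norm_ge0.
rewrite -[leRHS]mul1r; apply: le_mul_l2norm => // t.
by have := sqr_ge0 (l2norm (u + - t *: v)); rewrite sqr_l2normDZ sqrrN; lra.
Qed.

Lemma l2normN (R : realType) (n : nat) (u : 'cV[R]_n) : l2norm (- u) = l2norm u.
Proof. by congr Num.sqrt; apply: eq_bigr => i _; rewrite mxE sqrrN. Qed.

Lemma l2normD (R : realType) (n : nat) (u v : 'cV[R]_n) :
  l2norm (u + v) <= l2norm u + l2norm v.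
Proof.
rewrite -ler_sqr ?nnegrE ?addr_ge0 ?l2norm_ge0 //.
by rewrite -[v in leLHS]scale1r sqr_l2normDZ; have := dot_le u v; nra.
Qed.

(** * Restriction to index sets and restricted isometry *)

Definition restr (R : realType) (m : nat) (T : {set 'I_m}) (x : 'cV[R]_m) :
    'cV[R]_m :=
  \col_i (if i \in T then x i 0 else 0).

Lemma restr_supported (R : realType) (m : nat) (T : {set 'I_m})
  (x : 'cV[R]_m) : supported_on (restr T x) T.
Proof. by move=> i /negbTE iT; rewrite mxE iT. Qed.

Lemma restrDC (R : realType) (m : nat) (T : {set 'I_m}) (x : 'cV[R]_m) :
  x = restr T x + restr (~: T) x.
Proof.
apply/matrixP => i j; rewrite ord1 !mxE inE.
by case: (i \in T); rewrite ?addr0 ?add0r.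
Qed.

Lemma sqr_l2norm_supported (R : realType) (m : nat) (T : {set 'I_m})
  (x : 'cV[R]_m) : supported_on x T ->
  l2norm x ^+ 2 = \sum_(i in T) x i 0 ^+ 2.
Proof.
move=> xT; rewrite sqr_l2norm big_mkcond [RHS]big_mkcond /=.
by apply: eq_bigr => i _; case: ifPn => // /xT ->; rewrite expr0n.
Qed.

Lemma sqr_l2norm_restr (R : realType) (m : nat) (T : {set 'I_m})
  (x : 'cV[R]_m) : l2norm (restr T x) ^+ 2 = \sum_(i in T) x i 0 ^+ 2.
Proof.
rewrite (sqr_l2norm_supported (@restr_supported _ _ T x)).
by apply: eq_bigr => i iT; rewrite mxE iT.
Qed.

(** Passing from column submatrices to zero-padded vectors of full length lets vectors with
    different supports be added. *)
Lemma rip_bound_supported (R : realType) (n m : nat) (A : 'M[R]_(n, m))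
    (k : nat) (d : R) (T : {set 'I_m}) (x : 'cV[R]_m) :
  rip_bound A k d -> supported_on x T -> (#|T| <= k)%N ->
  (1 - d) * l2norm x ^+ 2 <= l2norm (A *m x) ^+ 2 <= (1 + d) * l2norm x ^+ 2.
Proof.
move=> Ad xT Tk; pose c : 'cV[R]_#|T| := \col_j x (enum_val j) 0.
have cx : l2norm c ^+ 2 = l2norm x ^+ 2.
  rewrite (sqr_l2norm_supported xT) sqr_l2norm [RHS]big_enum_val.
  by apply: eq_bigr => i _; rewrite mxE.
have Acx : submatrix A T *m c = A *m x.
  apply/matrixP => i j; rewrite ord1 !mxE.
  rewrite (bigID (mem T)) /= [X in _ = _ + X]big1 ?addr0 => [|l /xT ->];
    last by rewrite mulr0.
  rewrite [RHS]big_enum_val; apply: eq_bigr => l _.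
  by rewrite !mxE.
by rewrite -cx -Acx; apply/andP; exact: Ad.
Qed.

(** Disjoint supports make [x] and [z] orthogonal. Subtracting the lower bound at [x - t z] from the
    upper bound at [x + t z] isolates the inner product of the images; optimizing over [t] then
    turns the sum of squares into a product. *)
Lemma rip_bound_dot (R : realType) (n m : nat) (A : 'M[R]_(n, m))
    (k : nat) (d : R) (T U : {set 'I_m}) (x z : 'cV[R]_m) :
  rip_bound A k d -> supported_on x T -> supported_on z U ->
  [disjoint T & U] -> (#|T| + #|U| <= k)%N ->
  dot (A *m x) (A *m z) <= d * (l2norm x * l2norm z).
Proof.
move=> Ad xT zU TU TUk.
have xz : dot x z = 0.
  rewrite /dot big1 // => i _; have [iT|/xT ->] := boolP (i \in T).
    by rewrite zU ?mulr0 // (disjointFr TU).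
  by rewrite mul0r.
have xzTU t : supported_on (x + t *: z) (T :|: U).
  move=> i; rewrite inE negb_or => /andP[/xT xi /zU zi].
  by rewrite !mxE xi zi mulr0 addr0.
have TUc : (#|T :|: U| <= k)%N.
  by apply: leq_trans TUk; rewrite cardsU leq_subr.
have key t : 4 * t * dot (A *m x) (A *m z) <=
    2 * d * (l2norm x ^+ 2 + t ^+ 2 * l2norm z ^+ 2).
  have /andP[_ +] := rip_bound_supported Ad (xzTU t) TUc.
  have /andP[+ _] := rip_bound_supported Ad (xzTU (- t)) TUc.
  rewrite !mulmxDr -!scalemxAr !sqr_l2normDZ xz sqrrN; lra.
have [->|xn] := eqVneq x 0.
  by rewrite mulmx0 dotC dot0r l2norm0 mul0r mulr0.
have [->|zn] := eqVneq z 0; first by rewrite mulmx0 dot0r l2norm0 !mulr0.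
by apply: le_mul_l2norm => // t; have := key t; lra.
Qed.

(** * Largest entries and the fractional knapsack *)

(** Greedy choice by induction on [s]. The threshold [t] serves as dual variable of the knapsack,
    and [t * s = t * #|U|] is complementary slackness: [t = 0] unless [U] has exactly [s]
    elements. *)
Lemma largest_entries (R : realType) (I : finType) (Q : {set I}) (w : I -> R)
    (s : nat) : (forall i, 0 <= w i) ->
  exists (U : {set I}) (t : R), [/\ U \subset Q, (#|U| <= s)%N,
    0 <= t /\ t * s%:R = t * #|U|%:R,
    forall i, i \in U -> t <= w i &
    forall i, i \in Q :\: U -> w i <= t].
Proof.
move=> w0; elim: s => [|s [U [t [UQ Us [t0 ts] Uw wU]]]].
  (* For [s = 0] any upper bound of [w] can be the threshold; the total sum is one. *)
  exists set0, (\sum_i w i); rewrite sub0set cards0 sumr_ge0 //.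
  split => // i; first by rewrite inE.
  by move=> _; rewrite (bigD1 i) //= lerDl sumr_ge0.
have [QU0|[j jQU]] := set_0Vmem (Q :\: U).
  exists U, 0; rewrite !mul0r; split => //; first exact: leqW.
  by move=> i; rewrite QU0 inE.
case: (arg_maxP w jQU) => l lQU lmax.
have /setDP[lQ lU] : l \in Q :\: U by [].
have [wl0|wln] := eqVneq (w l) 0.
  (* Only zeros remain outside [U], so [U] need not grow and the threshold drops to 0. *)
  exists U, 0; rewrite !mul0r; split => //; first exact: leqW.
  by move=> i iQU; rewrite -wl0; exact: lmax.
have t_gt0 : 0 < t.
  by apply: lt_le_trans (wU _ lQU); rewrite lt_def wln w0.
have Us' : #|U| = s.
  apply/eqP; rewrite -(eqr_nat R) eq_sym; apply/eqP.
  exact: (mulfI (lt0r_neq0 t_gt0)).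
exists (l |: U), (w l); split.
- by rewrite subUset sub1set lQ.
- by rewrite cardsU1 lU Us'.
- by rewrite cardsU1 lU Us'.
- move=> i; rewrite !inE => /orP[/eqP -> //|/Uw]; exact/le_trans/wU.
- move=> i /setDP[iQ]; rewrite in_setU1 negb_or => /andP[_ iU].
  by apply: lmax; apply/setDP.
Qed.

(* Fractional knapsack: a vector with entries in [0, b] and sum at most s b
   pairs with w no better than b times the indicator of the s largest entries
   of w. *)
Lemma sum_mul_le_largest (R : realType) (I : finType) (Q : {set I})
    (v w : I -> R) (s : nat) (b : R) :
  (forall i, 0 <= w i) -> (forall i, i \in Q -> 0 <= v i <= b) ->
  \sum_(i in Q) v i <= s%:R * b ->
  exists U : {set I}, [/\ U \subset Q, (#|U| <= s)%N &
    \sum_(i in Q) v i * w i <= b * \sum_(i in U) w i].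
Proof.
move=> w0 vb vs.
have [U [t [UQ Us [t0 ts] Uw wU]]] := largest_entries Q s w0.
exists U; split => //.
have QU : Q :&: U = U by apply/setIidPr.
have split_Q (F : I -> R) :
    \sum_(i in Q) F i = \sum_(i in U) F i + \sum_(i in Q :\: U) F i.
  by rewrite (big_setID U) /= QU.
have vt : \sum_(i in Q :\: U) v i * w i <= t * \sum_(i in Q :\: U) v i.
  rewrite mulr_sumr; apply: ler_sum => i iQU; rewrite mulrC ler_wpM2r ?wU //.
  by case/setDP: iQU => /vb /andP[].
(* This sums [(b - v i) * (w i - t) >= 0] over [U]. Since [t * #|U| = t * s], the subtracted term
   absorbs the contribution of [Q :\: U]. *)
have vU : \sum_(i in U) v i * w i <=
    b * \sum_(i in U) w i - t * (b * #|U|%:R - \sum_(i in U) v i).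
  rewrite [b * #|U|%:R]mulr_natr -sumr_const -sumrB !mulr_sumr -sumrB.
  apply: ler_sum => i iU.
  have /andP[_] := vb _ (subsetP UQ _ iU).
  have := Uw _ iU; nra.
rewrite split_Q in vs; rewrite split_Q.
have := ler_wpM2l t0 vs; rewrite mulrA ts; lra.
Qed.

(** * From the cone condition to a norm estimate *)

(** Cauchy-Schwarz for the indicator of [T] and the absolute values of [x] on [T]. *)
Lemma sqr_sum_norm_le (R : realType) (m : nat) (T : {set 'I_m})
    (x : 'cV[R]_m) :
  (\sum_(i in T) `|x i 0|) ^+ 2 <= #|T|%:R * \sum_(i in T) x i 0 ^+ 2.
Proof.
pose u : 'cV[R]_m := restr T (const_mx 1).
pose v : 'cV[R]_m := restr T (\col_i `|x i 0|).
have -> : \sum_(i in T) `|x i 0| = dot u v.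
  rewrite big_mkcond; apply: eq_bigr => i _; rewrite !mxE.
  by case: ifP; rewrite ?mul1r ?mul0r.
have -> : #|T|%:R = l2norm u ^+ 2.
  rewrite sqr_l2norm_restr (eq_bigr (fun=> 1)) ?sumr_const // => i _.
  by rewrite mxE expr1n.
have -> : \sum_(i in T) x i 0 ^+ 2 = l2norm v ^+ 2.
  by rewrite sqr_l2norm_restr; apply: eq_bigr => i _;
    rewrite mxE real_normK ?num_real.
rewrite -exprMn ler_sqr ?nnegrE ?dot_le ?mulr_ge0 ?l2norm_ge0 //.
apply: sumr_ge0 => i _; rewrite !mxE.
by case: ifP => _; rewrite ?mulr0 // mulr_ge0.
Qed.

Lemma restr_sum (R : realType) (m : nat) (T : {set 'I_m}) (x : 'cV[R]_m) :
  restr T x = \sum_(i in T) x i 0 *: delta_mx i 0.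
Proof.
apply/matrixP => i j; rewrite ord1 !mxE summxE.
have [iT|iT] := boolP (i \in T).
  rewrite (bigD1 i) //= big1 ?addr0 => [|l /andP[_ li]]; last first.
    by rewrite !mxE eq_sym (negbTE li) mulr0.
  by rewrite !mxE !eqxx mulr1.
rewrite big1 // => l lT; rewrite !mxE.
have [il|_] := eqVneq i l; last by rewrite mulr0.
by rewrite il lT in iT.
Qed.

(** [N] stands for the norm of the main part [p] of [h]; leaving it existential hides the set
    [P]. *)
Lemma rip_bound_cone (R : realType) (n m : nat) (A : 'M[R]_(n, m)) (S : nat)
    (d : R) (T : {set 'I_m}) (h : 'cV[R]_m) :
  (0 < S)%N -> 0 <= d -> rip_bound A (3 * S) d -> (#|T| <= S)%N ->
  \sum_(i in ~: T) `|h i 0| <= \sum_(i in T) `|h i 0| ->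
  exists N : R, [/\ 0 <= N, l2norm h ^+ 2 <= 3 / 2 * N ^+ 2 &
    (1 - d - d * Num.sqrt (1 / 2)) * N <= Num.sqrt (1 + d) * l2norm (A *m h)].
Proof.
move=> S0 d0 Ad TS hT.
have SR0 : 0 < S%:R :> R by rewrite ltr0n.
pose b := (\sum_(i in T) `|h i 0|) / (2 * S%:R).
have b0 : 0 <= b by rewrite divr_ge0 ?sumr_ge0 ?mulr_ge0.
have hb : \sum_(i in T) `|h i 0| = 2 * S%:R * b.
  by rewrite mulrC divfK // mulf_neq0 ?lt0r_neq0.
(* If [b = 0], then [h] vanishes on [T], hence everywhere by the cone condition. *)
have [bz|bn] := eqVneq b 0.
  have h0 : h = 0.
    have hT0 : \sum_(i in T) `|h i 0| = 0 by rewrite hb bz mulr0.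
    rewrite hT0 in hT.
    apply/matrixP => i j; rewrite ord1 mxE; apply/eqP; rewrite -normr_le0.
    have [iT|iT] := boolP (i \in T).
      by rewrite -hT0 (bigD1 i) //= lerDl sumr_ge0.
    by apply: le_trans hT; rewrite (bigD1 i) ?inE //= lerDl sumr_ge0.
  exists 0; rewrite h0 mulmx0 !l2norm0 !mulr0 !expr0n /= mulr0.
  by split.
have {bn} b_gt0 : 0 < b by rewrite lt_def bn.
pose P1 := [set i in ~: T | b < `|h i 0|].
pose P := T :|: P1.
have P1T : P1 \subset ~: T by apply/subsetP => i; rewrite inE => /andP[].
have CP : ~: P = ~: T :\: P1 by rewrite setCU setDE.
have sum_CP : \sum_(i in ~: P) `|h i 0| + \sum_(i in P1) `|h i 0| =
    \sum_(i in ~: T) `|h i 0|.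
  rewrite CP [RHS](big_setID P1) /= addrC; congr (_ + _).
  by rewrite (setIidPr P1T).
have P1b : #|P1|%:R * b <= \sum_(i in P1) `|h i 0|.
  rewrite mulrC mulr_natr -sumr_const; apply: ler_sum => i.
  by rewrite inE => /andP[_ /ltW].
have P1S : (#|P1| <= 2 * S)%N.
  rewrite -(ler_nat R) -(ler_pM2r b_gt0) natrM.
  have : 0 <= \sum_(i in ~: P) `|h i 0| by rewrite sumr_ge0.
  lra.
have CPb i : i \in ~: P -> 0 <= `|h i 0| <= b.
  by rewrite CP !inE normr_ge0 => /andP[/nandP[/negPf ->//|]]; rewrite -leNgt.
(* Each index in [P1] uses up at least [b] of the total [2 S b], so the knapsack has capacity
   [2 S - #|P1|]; this keeps [#|P| + #|U|] within [3 S]. *)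
have sCP : \sum_(i in ~: P) `|h i 0| <= (2 * S - #|P1|)%:R * b.
  rewrite natrB // natrM; lra.
pose p := restr P h.
pose w i := `|dot (A *m p) (A *m delta_mx i 0)|.
have [U [UP Us Uw]] :=
  sum_mul_le_largest (fun i => normr_ge0 _ : 0 <= w i) CPb sCP.
(* The signs turn each inner product into its absolute value, the weight [w i]. *)
pose u : 'cV[R]_m :=
  restr U (\col_i (b * Num.sg (dot (A *m p) (A *m delta_mx i 0)))).
have dot_restr (V : {set 'I_m}) (x : 'cV[R]_m) :
    dot (A *m p) (A *m restr V x) =
    \sum_(i in V) x i 0 * dot (A *m p) (A *m delta_mx i 0).
  rewrite restr_sum mulmx_sumr dot_sumr; apply: eq_bigr => i _.
  by rewrite -scalemxAr dotZr.
have dotu : dot (A *m p) (A *m u) = b * \sum_(i in U) w i.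
  rewrite dot_restr mulr_sumr; apply: eq_bigr => i _.
  by rewrite mxE -mulrA -normrEsg.
have dotCP : - dot (A *m p) (A *m restr (~: P) h) <= dot (A *m p) (A *m u).
  rewrite dotu; apply: le_trans Uw; rewrite dot_restr -sumrN.
  apply: ler_sum => i _; rewrite -normrM -normrN; exact: ler_norm.
have PU : [disjoint P & U].
  by rewrite disjoint_sym disjoints_subset.
have PUS : (#|P| + #|U| <= 3 * S)%N.
  have : (#|P| <= #|T| + #|P1|)%N by rewrite cardsU leq_subr.
  move=> /leq_add /(_ Us) /leq_trans; apply.
  by rewrite -addnA subnKC // (mulSn 2) leq_add2r.
have pS : supported_on p P by exact: restr_supported.
have uS : supported_on u U by exact: restr_supported.
have dpu := rip_bound_dot Ad pS uS PU PUS.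
(* Cauchy-Schwarz on [T] gives [(2 S b)^2 <= S |p|^2]. The resulting bound controls both [u] and the
   tail of [h]. *)
have hb_p : 2 * S%:R * b ^+ 2 <= 1 / 2 * l2norm p ^+ 2.
  have PT : P :&: T = T by apply/setIidPr; exact: subsetUl.
  have hTp : \sum_(i in T) h i 0 ^+ 2 <= l2norm p ^+ 2.
    rewrite sqr_l2norm_restr [leRHS](big_setID T) /= PT lerDl.
    by apply: sumr_ge0 => i _; exact: sqr_ge0.
  have := sqr_sum_norm_le T h; rewrite hb => H.
  have : S%:R * (4 * S%:R * b ^+ 2) <= S%:R * l2norm p ^+ 2.
    have -> : S%:R * (4 * S%:R * b ^+ 2) = (2 * S%:R * b) ^+ 2 by ring.
    apply: le_trans H _; apply: ler_pM => //; last by rewrite ler_nat.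
    by apply: sumr_ge0 => i _; exact: sqr_ge0.
  rewrite ler_pM2l //; lra.
have p0 := l2norm_ge0 p.
have u_p : l2norm u <= Num.sqrt (1 / 2) * l2norm p.
  rewrite -ler_sqr ?nnegrE ?mulr_ge0 ?sqrtr_ge0 ?l2norm_ge0 //.
  rewrite exprMn [Num.sqrt (1 / 2) ^+ 2]sqr_sqrtr ?divr_ge0 //.
  apply: le_trans hb_p.
  have ub : l2norm u ^+ 2 <= #|U|%:R * b ^+ 2.
    rewrite sqr_l2norm_restr mulrC mulr_natr -sumr_const.
    apply: ler_sum => i _; rewrite mxE exprMn sqr_sg.
    by rewrite ler_piMr ?sqr_ge0 // lern1 leq_b1.
  apply: le_trans ub _; rewrite ler_wpM2r ?sqr_ge0 // -natrM ler_nat.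
  by apply: leq_trans Us _; exact: leq_subr.
have h_p : l2norm h ^+ 2 <= 3 / 2 * l2norm p ^+ 2.
  have hP : l2norm h ^+ 2 = l2norm p ^+ 2 + \sum_(i in ~: P) h i 0 ^+ 2.
    rewrite sqr_l2norm_restr sqr_l2norm (bigID (mem P)) /=.
    by congr (_ + _); apply: eq_bigl => i; rewrite in_setC.
  have : \sum_(i in ~: P) h i 0 ^+ 2 <= b * \sum_(i in ~: P) `|h i 0|.
    rewrite mulr_sumr; apply: ler_sum => i /CPb /andP[h0 hib].
    by rewrite -[leLHS]real_normK ?num_real // expr2 ler_wpM2r.
  have : b * \sum_(i in ~: P) `|h i 0| <= b * (2 * S%:R * b).
    rewrite ler_wpM2l // -hb; apply: le_trans hT.
    by rewrite -sum_CP lerDl sumr_ge0.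
  have -> : b * (2 * S%:R * b) = 2 * S%:R * b ^+ 2 by ring.
  lra.
have PS : (#|P| <= 3 * S)%N by apply: leq_trans PUS; exact: leq_addr.
have /andP[Ap_ge Ap_le] := rip_bound_supported Ad pS PS.
have Ap : l2norm (A *m p) <= Num.sqrt (1 + d) * l2norm p.
  rewrite -ler_sqr ?nnegrE ?mulr_ge0 ?sqrtr_ge0 ?l2norm_ge0 //.
  by rewrite exprMn [Num.sqrt (1 + d) ^+ 2]sqr_sqrtr ?addr_ge0.
exists (l2norm p); split => //.
have [->|pn] := eqVneq (l2norm p) 0.
  by rewrite mulr0 mulr_ge0 ?sqrtr_ge0 ?l2norm_ge0.
have p_gt0 : 0 < l2norm p by rewrite lt_def pn.
(* After multiplication by [|p|], both sides bracket the inner product of [A p] and [A h]: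
   restricted isometry from below, Cauchy-Schwarz from above. *)
rewrite -(ler_pM2l p_gt0).
have dotAh : dot (A *m p) (A *m h) =
    l2norm (A *m p) ^+ 2 + dot (A *m p) (A *m restr (~: P) h).
  by rewrite {1}(restrDC P h) mulmxDr dotDr dotvv.
have dotAh_le := dot_le (A *m p) (A *m h).
have := ler_wpM2r (l2norm_ge0 (A *m h)) Ap.
have := ler_wpM2l (mulr_ge0 d0 p0) u_p.
rewrite dotAh in dotAh_le.
move: dpu dotCP dotAh_le Ap_ge; rewrite !expr2; lra.
Qed.

(** The l1 norm of [xs] is at most that of the feasible [x0]. Off [T] the difference equals [xs]; on
    [T] the triangle inequality costs at most the l1 mass of the difference there. *)
Lemma is_solution_cone (R : realType) (n m : nat) (A : 'M[R]_(n, m))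
    (y : 'cV[R]_n) (eps : R) (x0 xs : 'cV[R]_m) (T : {set 'I_m}) :
  supported_on x0 T -> feasible A y eps x0 -> is_solution A y eps xs ->
  \sum_(i in ~: T) `|(xs - x0) i 0| <= \sum_(i in T) `|(xs - x0) i 0|.
Proof.
move=> x0T x0f [_ /(_ _ x0f)].
have splitT (F : 'I_m -> R) :
    \sum_i F i = \sum_(i in T) F i + \sum_(i in ~: T) F i.
  rewrite (bigID (mem T)) /=.
  by congr (_ + _); apply: eq_bigl => i; rewrite in_setC.
rewrite /l1norm !splitT.
rewrite [X in _ <= _ + X]big1 => [|i]; last first.
  by rewrite in_setC => /x0T ->; rewrite normr0.
have -> : \sum_(i in ~: T) `|(xs - x0) i 0| = \sum_(i in ~: T) `|xs i 0|.
  apply: eq_bigr => i; rewrite in_setC !mxE => /x0T ->.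
  by rewrite subr0.
have : \sum_(i in T) `|x0 i 0| <=
    \sum_(i in T) `|xs i 0| + \sum_(i in T) `|(xs - x0) i 0|.
  rewrite -big_split; apply: ler_sum => i _; rewrite !mxE.
  by rewrite -{1}(subKr (xs i 0) (x0 i 0)) ler_normB.
lra.
Qed.

(** * The stability constant and its numerical values *)

(* For d < 1/2 this is the constant of the paper with delta_3S bounded by
   delta_4S.  It blows up at d = 1/2, whereas delta_4S may be as large as 2/3;
   delta_3S <= 1/2 always holds, which gives the second constant. *)
Definition stability_constant (R : realType) (d : R) : R :=
  if d < 1 / 2 then
    2 * Num.sqrt (4 / 3) / (Num.sqrt (1 - d) - Num.sqrt ((1 + d) / 3))
  else 6 / (1 - Num.sqrt (1 / 2)).

Lemma stability_constant_ge0 (R : realType) (d : R) :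
  0 <= stability_constant d.
Proof.
rewrite /stability_constant; case: ltP => d_half; rewrite divr_ge0 ?subr_ge0 //.
- by rewrite mulr_ge0 // sqrtr_ge0.
- by rewrite ler_wsqrtr //; lra.
- by rewrite -[leRHS]sqrtr1 ler_wsqrtr //; lra.
Qed.

Lemma sqrt_bounds (R : realType) (x l u : R) :
  0 <= l -> 0 <= u -> l ^+ 2 <= x <= u ^+ 2 -> l <= Num.sqrt x <= u.
Proof.
move=> l0 u0 /andP[lx xu]; apply/andP; split.
  by rewrite -(ger0_norm l0) -sqrtr_sqr ler_wsqrtr.
by rewrite -(ger0_norm u0) -sqrtr_sqr ler_wsqrtr.
Qed.

Lemma stability_constant_15 (R : realType) :
  `|stability_constant (1 / 5 : R) - 882 / 100| <= 5 / 1000.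
Proof.
rewrite /stability_constant ifT; last lra.
(* The exact value is about 8.8155, less than 0.0005 inside the tolerance, hence the tight rational
   brackets. *)
have /andP[s1 s2] :
    1560 / 1351 <= Num.sqrt (4 / 3 : R) <= 1351 / 1170.
  by apply: sqrt_bounds; lra.
have /andP[a1 a2] :
    1364 / 1525 <= Num.sqrt (1 - 1 / 5 : R) <= 305 / 341.
  by apply: sqrt_bounds; lra.
have /andP[r1 r2] :
    456 / 721 <= Num.sqrt ((1 + 1 / 5) / 3 : R) <= 721 / 1140.
  by apply: sqrt_bounds; lra.
by rewrite ler_norml lerBrDr lerBlDr ler_pdivlMr ?ler_pdivrMr; lra.
Qed.

Lemma stability_constant_14 (R : realType) :
  `|stability_constant (1 / 4 : R) - 1047 / 100| <= 5 / 1000.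
Proof.
rewrite /stability_constant ifT; last lra.
have /andP[s1 s2] :
    1560 / 1351 <= Num.sqrt (4 / 3 : R) <= 1351 / 1170.
  by apply: sqrt_bounds; lra.
have /andP[a1 a2] :
    989 / 1142 <= Num.sqrt (1 - 1 / 4 : R) <= 1351 / 1560.
  by apply: sqrt_bounds; lra.
have /andP[r1 r2] :
    559 / 866 <= Num.sqrt ((1 + 1 / 4) / 3 : R) <= 681 / 1055.
  by apply: sqrt_bounds; lra.
by rewrite ler_norml lerBrDr lerBlDr ler_pdivlMr ?ler_pdivrMr; lra.
Qed.

Lemma le_stability_constant (R : realType) (d3 d4 eps N L : R) :
  0 <= d3 -> d3 <= d4 -> d3 <= 1 / 2 -> 0 <= eps -> 0 <= N -> 0 <= L ->
  L ^+ 2 <= 3 / 2 * N ^+ 2 ->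
  (1 - d3 - d3 * Num.sqrt (1 / 2)) * N <= Num.sqrt (1 + d3) * (2 * eps) ->
  L <= stability_constant d4 * eps.
Proof.
move=> d3_ge0 d34 d3_le eps0 N0 L0 LN H.
have /andP[k0 k1] :
    0 <= Num.sqrt (1 / 2 : R) <= 3 / 4.
  by apply: sqrt_bounds; lra.
set k := Num.sqrt (1 / 2 : R) in H k0 k1 *.
pose q : R := Num.sqrt (3 / 2).
have q0 : 0 <= q by exact: sqrtr_ge0.
have qq : q * q = 3 / 2 by rewrite -expr2 sqr_sqrtr //; lra.
have LqN : L <= q * N.
  by rewrite -ler_sqr ?nnegrE ?mulr_ge0 // exprMn [q ^+ 2]expr2 qq.
rewrite /stability_constant -/k; case: ltP => d4_half; rewrite mulrAC.
- set a := Num.sqrt (1 - d4); set r := Num.sqrt ((1 + d4) / 3).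
  have a0 : 0 <= a by exact: sqrtr_ge0.
  have r0 : 0 <= r by exact: sqrtr_ge0.
  have aa : a * a = 1 - d4 by rewrite -expr2 sqr_sqrtr //; lra.
  have rr : r * r = (1 + d4) / 3 by rewrite -expr2 sqr_sqrtr //; lra.
  have ra : r < a by rewrite ltr_sqrt; lra.
  pose t : R := Num.sqrt 3.
  have t0 : 0 <= t by exact: sqrtr_ge0.
  have tt : t * t = 3 by rewrite -expr2 sqr_sqrtr.
  have tr : Num.sqrt (1 + d3) <= t * r.
    rewrite -sqrtrM // ler_wsqrtr //; lra.
  (* Multiplying by [a + r] reduces this to [H]: [3/2 (a^2 - r^2) = 1 - 2 d4] is at most the factor
     of [N] there, as [k <= 1] and [d3 <= d4], while [r < a] gives [2 r <= a + r]. *)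
  have NE : 3 / 2 * (a - r) * N <= t * eps.
    have ar_gt0 : 0 < a + r by lra.
    rewrite -(ler_pM2r ar_gt0).
    have -> : 3 / 2 * (a - r) * N * (a + r) = 3 / 2 * (a * a - r * r) * N.
      by ring.
    rewrite aa rr.
    have : (1 - 2 * d4) * N <= (1 - d3 - d3 * k) * N.
      by rewrite ler_wpM2r //; nra.
    have := ler_wpM2r (mulr_ge0 (ler0n R 2) eps0) tr.
    have := ler_wpM2l (mulr_ge0 t0 eps0) (ltW ra).
    move: H; lra.
  (* The left side is [sqrt (9/2)], below 3, so the crude bound [sqrt (4/3) >= 1] suffices. *)
  have qt : q * t <= 3 * Num.sqrt (4 / 3).
    have /andP[s1 _] : 1 <= Num.sqrt (4 / 3 : R) <= 2.
      by apply: sqrt_bounds; lra.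
    rewrite -ler_sqr ?nnegrE ?mulr_ge0 ?sqrtr_ge0 //.
    rewrite exprMn [q ^+ 2]expr2 [t ^+ 2]expr2 qq tt; nra.
  rewrite ler_pdivlMr ?subr_gt0 //.
  have ar : 0 <= a - r by lra.
  have := ler_wpM2r ar LqN.
  have := ler_wpM2l q0 NE.
  have := ler_wpM2r eps0 qt.
  lra.
- rewrite ler_pdivlMr; last lra.
  have dq : Num.sqrt (1 + d3) <= q by rewrite ler_wsqrtr //; lra.
  (* By [d3 <= 1/2] the factor of [N] in [H] is at least [(1 - k) / 2]. The constant 6 arises as
     [4 q^2]. *)
  have kN : (1 - k) * N <= 4 * (q * eps).
    have : (1 - 1 / 2 - k / 2) * N <= (1 - d3 - d3 * k) * N.
      by rewrite ler_wpM2r //; nra.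
    have := ler_wpM2r (mulr_ge0 (ler0n R 2) eps0) dq.
    move: H; lra.
  have k1' : 0 <= 1 - k by lra.
  have := ler_wpM2r k1' LqN.
  have := ler_wpM2l q0 kN.
  have -> : q * (4 * (q * eps)) = 4 * (q * q) * eps by ring.
  rewrite qq; lra.
Qed.

(** * Monotonicity of the isometry constants and assembly of the estimate *)

Lemma ric_homo (R : realType) (n m : nat) (A : 'M[R]_(n, m)) (k l : nat) :
  (0 < k)%N -> (k <= l)%N -> (0 < m)%N -> ric A k <= ric A l.
Proof.
move=> k0 kl m0; apply: ric_le => // T c Tk.
apply: ric_rip_bound => //; first exact: leq_trans kl.
exact: leq_trans kl.
Qed.

Theorem theorem1 (R : realType) :
  exists C : R -> R,
    (forall (n m : nat) (A : 'M[R]_(n, m)) (S : nat),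
       (1 <= S)%N ->
       ric A (3 * S) + 3 * ric A (4 * S) < 2 ->
       forall eps : R, 0 <= eps ->
       forall (x0 : 'cV[R]_m) (T0 : {set 'I_m}),
         supported_on x0 T0 -> (#|T0| <= S)%N ->
       forall e : 'cV[R]_n, l2norm e <= eps ->
       forall xs : 'cV[R]_m, is_solution A (A *m x0 + e) eps xs ->
         l2norm (xs - x0) <= C (ric A (4 * S)) * eps) /\
    `|C (1 / 5) - 882 / 100| <= 5 / 1000 /\
    `|C (1 / 4) - 1047 / 100| <= 5 / 1000.
Proof.
exists (@stability_constant R); split; last first.
  by split; [exact: stability_constant_15|exact: stability_constant_14].
move=> n m A S S0 ricA eps eps0 x0 T0 x0T T0S e e_eps xs xsP.
have x0f : feasible A (A *m x0 + e) eps x0.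
  by rewrite /feasible opprD addrA subrr add0r l2normN.
have hcone := is_solution_cone x0T x0f xsP.
have hA : l2norm (A *m (xs - x0)) <= 2 * eps.
  have -> : A *m (xs - x0) = (A *m xs - (A *m x0 + e)) + e.
    by rewrite opprD addrA subrK mulmxBr.
  apply: le_trans (l2normD _ _) _; rewrite mulr_natl mulr2n.
  by apply: lerD => //; case: xsP.
have [m0|m0] := posnP m.
  have -> : xs - x0 = 0.
    by apply/matrixP => i; have := ltn_ord i; rewrite [X in (_ < X)%N]m0.
  by rewrite l2norm0 mulr_ge0 // stability_constant_ge0.
have S3 : (0 < 3 * S)%N by rewrite muln_gt0.
have d34 : ric A (3 * S) <= ric A (4 * S).
  by apply: ric_homo => //; rewrite leq_mul2r orbT.
have Ad := ric_rip_bound A S3 m0.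
have d0 := rip_bound_ge0 S3 m0 Ad.
have [N [N0 hN AN]] := rip_bound_cone S0 d0 Ad T0S hcone.
(* The remaining condition [d3 <= 1/2] follows from [4 d3 <= d3 + 3 d4 < 2], with [d3] and [d4] the
   two isometry constants. *)
apply: (le_stability_constant d0 d34 _ eps0 N0 (l2norm_ge0 _) hN); first lra.
by apply: le_trans AN _; rewrite ler_wpM2l ?sqrtr_ge0.
Qed.
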